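(* There exist absolute constants $C > 0$ (sufficiently large) and $c > 0$ (sufficiently small) such that the following holds. Let $t = t(n)$ and $\alpha = \alpha(n)$ be integers with $t \geq \frac{C \log\log n}{\log\log\log n}$, $0 \leq \alpha < c\, t \log t$ and $\alpha = o(n)$. Then for every sufficiently large $n$, Client has a winning strategy for the $(1:q)$ Waiter-Client game $(E(K_n), \mathcal{M}_t)$ for every integer $q \geq n - \alpha$; that is, Client can ensure that at the end of the game his graph does not admit a $K_t$-minor.
   Context: $\log$ denotes the natural logarithm. The $(1:q)$ Waiter-Client game $(X,\mathcal{F})$ with board $X = E(K_n)$ and family of winning sets $\mathcal{F}$ is played as follows: in each round Waiter offers Client $q+1$ previously unoffered elements of $X$; Client claims one of them and Waiter claims the remaining $q$. If in the final round only $1 \le r < q+1$ free elements remain, Client claims $\max\{0, r-q\}$ of them and Waiter claims the rest. Waiter wins if at the end Client has claimed all elements of some $A \in \mathcal{F}$; otherwise Client wins. $\mathcal{M}_t$ is the family of edge sets of all subgraphs of $K_n$ that admit a $K_t$-minor. A graph $G$ admits a $K_t$-minor if there exist pairwise disjoint vertex sets $B_1,\dots,B_t \subseteq V(G)$ such that each $G[B_i]$ is connected and for every $i<j$ there is an edge of $G$ between $B_i$ and $B_j$. *)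

(* Defs.v *)
From mathcomp Require Import all_boot.

Set Implicit Arguments.
Unset Strict Implicit.
Unset Printing Implicit Defensive.

Section WaiterClientGame.
Variables (T : finType) (X : {set T}) (F : {set {set T}}) (q : nat).

(* The completed full rounds in chronological order: the pair (O, x) records
   that Waiter offered O, Client claimed x and Waiter claimed O :\ x. *)
Definition history := seq ({set T} * T).

Definition free_elements (h : history) : {set T} :=
  X :\: \bigcup_(r <- h) r.1.

Definition client_claimed (h : history) : {set T} :=
  [set x in [seq r.2 | r <- h]].

Definition client_strategy := history -> {set T} -> T.

Definition legal_strategy (s : client_strategy) : Prop :=
  forall (h : history) (O : {set T}), O != set0 -> s h O \in O.

Inductive consistent_play (s : client_strategy) : history -> Prop :=
| play_start : consistent_play s [::]
| play_round (h : history) (O : {set T}) :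
    consistent_play s h -> O \subset free_elements h -> #|O| = q.+1 ->
    consistent_play s (rcons h (O, s h O)).

(* When r < q + 1 elements are left, Client claims max(0, r - q) = 0 of them
   and Waiter claims the rest, so Client's final set is client_claimed h. *)
Definition game_over (h : history) : Prop := #|free_elements h| < q.+1.

Definition waiter_wins (h : history) : Prop :=
  exists2 A, A \in F & A \subset client_claimed h.

Definition client_has_winning_strategy : Prop :=
  exists s : client_strategy, legal_strategy s /\
    forall h, consistent_play s h -> game_over h -> ~ waiter_wins h.

End WaiterClientGame.

(* E(K_n): an edge is a two-element set of vertices. *)
Definition complete_edges (n : nat) : {set {set 'I_n}} :=
  [set e : {set 'I_n} | #|e| == 2].

Section Minors.
Variable V : finType.

Definition induced_adj (E : {set {set V}}) (B : {set V}) : rel V :=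
  [rel x y | [&& x \in B, y \in B & [set x; y] \in E]].

(* The empty graph is not connected. *)
Definition induces_connected (E : {set {set V}}) (B : {set V}) : bool :=
  (B != set0) && [forall x in B, forall y in B, connect (induced_adj E B) x y].

Definition edge_between (E : {set {set V}}) (A B : {set V}) : bool :=
  [exists x in A, exists y in B, [set x; y] \in E].

(* The graph with vertex set S and edge set E has a K_t-minor with branch sets
   B i, i < t. *)
Definition admits_complete_minor (S : {set V}) (E : {set {set V}}) (t : nat)
    : bool :=
  [exists B : {ffun 'I_t -> {set V}},
    [&& [forall i, B i \subset S],
        [forall i, forall j, (i != j) ==> [disjoint B i & B j]],
        [forall i, induces_connected E (B i)] &
        [forall i : 'I_t, forall j : 'I_t,
           (i < j) ==> edge_between E (B i) (B j)]]].

End Minors.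

Definition subgraph_complete (n : nat) (S : {set 'I_n}) (E : {set {set 'I_n}})
    : bool :=
  (E \subset complete_edges n) && [forall e in E, e \subset S].

(* M_t: isolated vertices are accounted for by the choice of S. *)
Definition minor_family (n t : nat) : {set {set {set 'I_n}}} :=
  [set E : {set {set 'I_n}} |
    [exists S : {set 'I_n},
       subgraph_complete S E && admits_complete_minor S E t]].

(* Main.v *)
(* Client plays so as to have few cycles. If he chose uniformly at random, the
   expected number of his cycles would be at most the sum over 3 <= l <= n of
   (n / (q + 1))^l / l, that is at most e^(2 alpha) log n; minimizing the
   conditional expectation in each round, he never has more cycles than that.
   On the other hand a K_t-minor yields (t - 2)! cycles through a common vertex,
   one for each order in which the other t - 2 branch sets can be visited
   between two fixed ones, and log (t - 2)! exceeds log log n + 2 alpha. *)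

Require Import Defs.
From mathcomp Require Import all_boot all_order all_algebra.
From mathcomp Require Import zify ring lra.

Set Implicit Arguments.
Unset Strict Implicit.
Unset Printing Implicit Defensive.

Import Order.TTheory GRing.Theory Num.Theory.

Local Open Scope ring_scope.

(** * Client's strategy by conditional expectations *)

Section ClientPotential.
Variables (R : realFieldType) (T : finType) (X : {set T}) (q : nat).
Implicit Types (A O : {set T}) (h : history T).

Lemma client_claimed_rcons h O x :
  client_claimed (rcons h (O, x)) = x |: client_claimed h.
Proof. by apply/setP => z; rewrite !inE map_rcons mem_rcons inE. Qed.

Lemma free_elements_rcons h O x :
  free_elements X (rcons h (O, x)) = free_elements X h :\: O.
Proof. by rewrite /free_elements -cats1 big_cat big_seq1 /= setDDl. Qed.

(** An upper bound for the probability that a Client who chooses uniformly at random from now on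
    completes [A]: each missing element costs a factor 1/(q+1), and [A] is dead once one of its
    elements is neither claimed nor free. *)
Definition weight A h : R :=
  if A \subset client_claimed h :|: free_elements X h
  then (q.+1%:R ^+ #|A :\: client_claimed h|)^-1 else 0.

Lemma weight_ge0 A h : 0 <= weight A h.
Proof. by rewrite /weight; case: ifP => // _; rewrite invr_ge0 exprn_ge0. Qed.

Lemma weight_claimed A h : A \subset client_claimed h -> weight A h = 1.
Proof.
move=> sA; rewrite /weight (subset_trans sA (subsetUl _ _)).
by move: sA; rewrite -setD_eq0 => /eqP->; rewrite cards0 expr0 invr1.
Qed.

Lemma weight_start A : weight A [::] <= (q.+1%:R ^+ #|A|)^-1.
Proof.
rewrite /weight; have -> : client_claimed [::] = set0 :> {set T}.
  by apply/setP=> x; rewrite !inE.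
by rewrite setD0; case: ifP => // _; rewrite invr_ge0 exprn_ge0.
Qed.

(* If A meets O in an unclaimed element z, then only the choice x = z keeps A
   alive, and it multiplies the weight by q + 1. *)
Lemma sum_weight_round A h O :
  O \subset free_elements X h -> #|O| = q.+1 ->
  \sum_(x in O) weight A (rcons h (O, x)) <= q.+1%:R * weight A h.
Proof.
move=> sO cO; set cl := client_claimed h; set fr := free_elements X h.
have [sA|nsA] := boolP (A \subset cl :|: fr); last first.
  rewrite big1 ?mulr_ge0 ?weight_ge0 // => x xO.
  rewrite /weight client_claimed_rcons free_elements_rcons ifN //.
  apply: contra nsA => /subset_trans; apply.
  rewrite !subUset sub1set subsetUl (subset_trans (subsetDl _ _) (subsetUr _ _)).
  by rewrite !andbT in_setU (subsetP sO) ?orbT.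
have wh : weight A h = (q.+1%:R ^+ #|A :\: cl|)^-1 by rewrite /weight sA.
have [A0|[z]] := set_0Vmem ((A :\: cl) :&: O); last first.
  rewrite !inE => /andP[/andP[zncl zA] zO].
  rewrite (bigD1 z) //= big1 ?addr0 => [|x /andP[xO xz]]; last first.
    rewrite /weight client_claimed_rcons free_elements_rcons ifN //.
    apply/subsetPn; exists z => //.
    rewrite !in_setU !in_setD in_set1 zO /= orbF negb_or eq_sym xz /=.
    by rewrite in_set.
  rewrite wh /weight client_claimed_rcons.
  have cD : #|A :\: cl| = #|A :\: (z |: cl)|.+1.
    rewrite setUC -setDDl (cardsD1 z (A :\: cl)) !inE zA andbT.
    by rewrite zncl.
  rewrite cD exprS invfM mulrA divff ?mul1r ?pnatr_eq0 //.
  by case: ifP => // _; rewrite invr_ge0 exprn_ge0.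
(* Here the offer misses the unclaimed part of [A], so every one of the q+1 choices leaves the
   exponent unchanged. *)
rewrite mulr_natl -[X in _ *+ X]cO -sumr_const wh; apply: ler_sum => x xO.
rewrite /weight client_claimed_rcons -/cl.
have -> : A :\: (x |: cl) = A :\: cl.
  rewrite setUC -setDDl; apply/setDidPl; rewrite disjoint_sym disjoints1.
  apply: contraT => /negPn xA.
  by move/setP/(_ x): A0; rewrite in_set0 in_setI xA xO.
by case: ifP => // _; rewrite invr_ge0 exprn_ge0.
Qed.

(** Client always minimizes the total weight [Phi]; the minimum over an offer is at most the
    average, so by [sum_weight_round] [Phi] never increases. Indexing by a list with coefficients
    allows a winning set to be listed several times, with fractional weight. *)
Lemma client_weighted_count (x0 : T) (I : Type) (r : seq I) (c : I -> R)
    (A : I -> {set T}) : (forall i, 0 <= c i) ->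
  exists s : client_strategy T, legal_strategy s /\
    forall h, consistent_play X q s h ->
      \sum_(i <- r | A i \subset client_claimed h) c i
        <= \sum_(i <- r) c i / q.+1%:R ^+ #|A i|.
Proof.
move=> c0; pose Phi h := \sum_(i <- r) c i * weight (A i) h.
(* The default [x0] is returned on the empty offer only. *)
pose s h O := if [pick x in O] is Some y
  then [arg min_(x < y in O) Phi (rcons h (O, x))]%O else x0.
have sP h O : O != set0 -> s h O \in O /\
    forall x, x \in O -> Phi (rcons h (O, s h O)) <= Phi (rcons h (O, x)).
  move=> /set0Pn[y yO]; rewrite /s; case: pickP => [z zO|/(_ y)]; last by rewrite yO.
  by case: (arg_minP (fun x => Phi (rcons h (O, x))) zO).
exists s; split=> [h O O0|h]; first by case: (sP h O O0).
have Phi_noninc : consistent_play X q s h -> Phi h <= Phi [::].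
  elim=> // {}h O _ IH sO cO; apply: le_trans IH.
  have O0 : O != set0 by rewrite -card_gt0 cO.
  have [_ smin] := sP h O O0.
  rewrite -(ler_pM2l (_ : 0 < q.+1%:R)) ?ltr0n //.
  apply: (@le_trans _ _ (\sum_(x in O) Phi (rcons h (O, x)))).
    by rewrite mulr_natl -{1}cO -sumr_const; apply: ler_sum.
  rewrite /Phi exchange_big mulr_sumr /=; apply: ler_sum => i _.
  by rewrite -mulr_sumr mulrCA ler_wpM2l // sum_weight_round.
move=> /Phi_noninc PhiP; apply: (@le_trans _ _ (Phi h)).
  rewrite big_mkcond; apply: ler_sum => i _; case: ifP => [/weight_claimed->|_].
    by rewrite mulr1.
  by rewrite mulr_ge0 ?weight_ge0.
apply: le_trans PhiP _; apply: ler_sum => i _.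
by rewrite ler_wpM2l // weight_start.
Qed.

End ClientPotential.

(** * Cycles as vertex lists *)

Section CycleEdges.
Variable V : finType.
Implicit Types (c : seq V) (E : {set {set V}}).

Definition adj E : rel V := [rel x y | [set x; y] \in E].

Definition cycle_edges c : {set {set V}} := [set [set x; next c x] | x in c].

Lemma cycle_edges_sub E c : cycle (adj E) c -> cycle_edges c \subset E.
Proof.
by move=> cE; apply/subsetP => _ /imsetP[x xc ->]; exact: (next_cycle cE xc).
Qed.

(** If distinct x and y yielded the same edge, each would be the successor of the other, which
    forces length two. Rotating x to the front makes both successors visible. *)
Lemma card_cycle_edges c : uniq c -> (2 < size c)%N ->
  #|cycle_edges c| = size c.
Proof.
move=> Uc sc; rewrite card_in_imset ?(card_uniqP Uc) // => x y xc yc.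
have [//|xy] := eqVneq x y => /setP eqE.
have /set2P[/eqP|xy'] : x \in [set y; next c y] by rewrite -eqE set21.
  by rewrite (negPf xy).
have /set2P[/eqP|yx'] : y \in [set x; next c x] by rewrite eqE set21.
  by rewrite eq_sym (negPf xy).
have [i p def_c] := rot_to xc.
move: xy' yx'; rewrite -!(next_rot i Uc) def_c.
have : uniq (rot i c) by rewrite rot_uniq.
have : (2 < size (rot i c))%N by rewrite size_rot.
rewrite def_c; case: p {def_c} => [|a [|b p]] //= _.
rewrite !inE !negb_or eqxx => /andP[/and3P[xa xb _] _] + ya.
by rewrite ya eqxx eq_sym (negPf xa) => xb'; rewrite xb' eqxx in xb.
Qed.

(** The position of [y] in a rotated list determines both the offset and the original list, so
    rotations of different cycles starting at [y] never coincide. *)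
Lemma rot_index_uniq (y : V) p i : uniq (y :: p) -> (i <= size p)%N ->
  rot (index y (rot i (y :: p))) (rot i (y :: p)) = y :: p /\
  i = (if index y (rot i (y :: p)) is k.+1 then (size p - k)%N else 0%N).
Proof.
case: i => [|i] Uc ip; first by rewrite rot0 /= eqxx rot0.
have -> : index y (rot i.+1 (y :: p)) = (size p - i)%N.
  have ny : y \notin drop i p.
    by move: Uc => /= /andP[+ _]; apply: contra; apply: mem_drop.
  by rewrite /rot /= index_cat (negPf ny) size_drop /= eqxx addn0.
split; last by case E: (size p - i)%N => [|k]; lia.
by rewrite -[RHS](rotK i.+1) /rotr size_rot.
Qed.

End CycleEdges.

(** * Many cycles from a complete minor *)

Lemma undup_nseq_cat (T : eqType) m (x : T) s : x \notin s ->
  undup (nseq m.+1 x ++ s) = x :: undup s.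
Proof.
move=> xs; elim: m => [|m <-]; first by rewrite /= (negPf xs).
by rewrite [LHS]/= mem_head.
Qed.

Lemma lift_all_map (S T : eqType) (P : T -> Prop) (g : T -> S) (l : seq S) :
  (forall i, i \in l -> exists2 c, P c & g c = i) ->
  exists2 cs, (forall c, c \in cs -> P c) & map g cs = l.
Proof.
elim: l => [_|i l IH lP]; first by exists [::].
have [|cs Pcs defl] := IH; first by move=> j jl; apply: lP; rewrite inE jl orbT.
have [c Pc gc] := lP i (mem_head _ _).
exists (c :: cs); last by rewrite /= gc defl.
by move=> d; rewrite inE => /predU1P[->|/Pcs].
Qed.

Section MinorCycles.
Variables (V : finType) (E : {set {set V}}) (t : nat) (B : 'I_t -> {set V}).
Hypothesis disjB : forall i j, i != j -> [disjoint B i & B j].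
Hypothesis connB : forall i, induces_connected E (B i).
Hypothesis edgeB : forall i j, i != j -> edge_between E (B i) (B j).

(** On a path inside the branch sets that never returns to a set it has left, [undup (map branch p)]
    is the order of visits; this is the invariant that tells the cycles apart. *)
Let branch (x : V) : option 'I_t := [pick i | x \in B i].

Lemma branchP i x : x \in B i -> branch x = Some i.
Proof.
move=> xi; rewrite /branch; case: pickP => [j xj|/(_ i)]; last by rewrite xi.
congr Some; apply/eqP; apply: contraT => /disjB.
by move=> /disjoint_setI0/setP/(_ x); rewrite !inE xi xj.
Qed.

Lemma branch_segment i a b : a \in B i -> b \in B i ->
  exists p, [/\ path (adj E) a p, last a p = b, uniq (a :: p) &
    map branch (a :: p) = nseq (size p).+1 (Some i)].
Proof.
move=> ai bi; have /andP[_ /forall_inP/(_ a ai)/forall_inP/(_ b bi)] := connB i.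
case/connectP => p0 /shortenP[p pp Up _] ->; exists p; split=> //.
  by apply: sub_path pp => x y /and3P[].
have allB : all (mem (B i)) p.
  apply/allP => x xp; elim: p a {p0 ai Up} pp xp => //= z p IH a.
  case/andP => /and3P[_ zi _] pp; rewrite inE => /predU1P[->//|]; exact: IH pp.
rewrite /= (branchP ai); congr cons.
by elim: p allB {pp Up} => //= x p IH /andP[/branchP-> /IH->].
Qed.

(** Cross [B i] to the end of an edge leading into the next branch set, then recurse. The path stays
    simple because the label i does not occur on its later part. *)
Lemma branch_path l i a b : uniq (i :: l) -> a \in B i -> b \in B (last i l) ->
  exists p, [/\ path (adj E) a p, last a p = b, uniq (a :: p) &
    undup (map branch (a :: p)) = map Some (i :: l)].
Proof.
elim: l i a => [|j l IH] i a.
  move=> _ ai /(branch_segment ai)[p [pp lp Up mp]]; exists p; split=> //.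
  by rewrite mp -[nseq _ _]cats0 undup_nseq_cat.
rewrite cons_uniq => /andP[ijl Ujl] ai bl.
have ij : i != j by move: ijl; rewrite inE negb_or => /andP[].
have /exists_inP[u ui /exists_inP[w wj uw]] := edgeB ij.
have [p1 [pp1 lp1 Up1 mp1]] := branch_segment ai ui.
have [p2 [pp2 lp2 Up2 mp2]] := IH j w Ujl wj bl.
have ni : Some i \notin map branch (w :: p2).
  by rewrite -mem_undup mp2 mem_map // => ? ? [].
exists (p1 ++ w :: p2); split.
- by rewrite cat_path lp1 pp1 /= pp2 andbT.
- by rewrite last_cat.
- rewrite -cat_cons cat_uniq; apply/and3P; split=> //; apply/hasPn.
  move=> x /(map_f branch) xw; apply: contra ni => /(map_f branch).
  by rewrite mp1 => /nseqP[<-].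
- by rewrite -cat_cons map_cat mp1 undup_nseq_cat // mp2.
Qed.

End MinorCycles.

(** Fix an edge xy between two branch sets. For each order of the other t sets, a path from y to x
    visits them in that order, and xy closes it. The order can be read off the cycle, so distinct
    orders give distinct cycles. *)
Lemma complete_minor_cycles (V : finType) (S : {set V}) E t :
  admits_complete_minor S E t.+2 ->
  exists y cs, [/\ uniq cs, size cs = t`! &
    forall c, c \in cs ->
      [/\ uniq c, cycle (adj E) c, (t.+1 < size c)%N & ohead c = Some y]].
Proof.
case/existsP => B /and4P[_ /'forall_forallP disjB /forallP connB /'forall_forallP edgeB'].
have {}disjB i j : i != j -> [disjoint B i & B j].
  by move=> ij; apply: implyP ij; apply: disjB.
have edgeB i j : i != j -> edge_between E (B i) (B j).
  rewrite neq_ltn => /orP[ij|ji]; first exact: (implyP (edgeB' i j)).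
  move: (edgeB' j i) => /implyP/(_ ji).
  case/exists_inP => x xj /exists_inP[y yi xy].
  by apply/exists_inP; exists y => //; apply/exists_inP; exists x; rewrite // setUC.
pose i0 : 'I_t.+2 := ord0; pose i1 : 'I_t.+2 := lift ord0 ord0.
pose rest := [seq lift i0 (lift ord0 i) | i <- enum 'I_t].
have Urest : uniq rest.
  by rewrite map_inj_uniq ?enum_uniq // => i j /lift_inj/lift_inj.
have srest : size rest = t by rewrite size_map size_enum_ord.
have [i0rest i1rest] : i0 \notin rest /\ i1 \notin rest.
  by split; apply/mapP => -[i _ /(congr1 val)].
have /exists_inP[x xi0 /exists_inP[y yi1 xy]] := edgeB i0 i1 isT.
pose branch (v : V) : option 'I_t.+2 := [pick i | v \in B i].
pose full l := map Some (i1 :: rcons l i0).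
pose P c := [/\ uniq c, cycle (adj E) c, (t.+1 < size c)%N & ohead c = Some y].
have [|cs csP defcs] := @lift_all_map _ _ P (fun c => undup (map branch c))
    (map full (permutations rest)).
  move=> l' /mapP[l]; rewrite mem_permutations => lrest ->.
  have Ul : uniq (i1 :: rcons l i0).
    rewrite /= mem_rcons rcons_uniq (perm_uniq lrest) Urest andbT.
    by rewrite inE !(perm_mem lrest) i0rest i1rest.
  have xl : x \in B (last i1 (rcons l i0)) by rewrite last_rcons.
  have [p [pp lp Up mp]] := branch_path disjB connB edgeB Ul yi1 xl.
  exists (y :: p) => //; split=> //.
    by rewrite /= rcons_path pp lp.
  have := size_undup (map branch (y :: p)); rewrite mp !size_map /=.
  by rewrite size_rcons (perm_size lrest) srest.
exists y, cs; split=> //.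
  (* Distinct visiting orders force distinct cycles. *)
  apply: (@map_uniq _ _ (fun c => undup (map branch c))); rewrite defcs.
  rewrite map_inj_uniq ?permutations_uniq // => l l' /inj_map eql.
  by apply: (@rcons_injl _ i0); have [] := eql (@Some_inj _).
by rewrite -(size_map (fun c => undup (map branch c))) defcs size_map
  size_permutations // srest.
Qed.

(** * Weighted count of cycles *)

Lemma ler_sum_uniq_subset (R : numDomainType) (I : eqType) (F : I -> R)
    (r s : seq I) : (forall i, 0 <= F i) -> uniq r -> {subset r <= s} ->
  \sum_(i <- r) F i <= \sum_(i <- s) F i.
Proof.
move=> F0; elim: s r => [|a s IH] r Ur rs.
  by case: r rs {Ur} => [//|i r] /(_ i (mem_head _ _)).
rewrite big_cons; have [ar|anr] := boolP (a \in r).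
  rewrite (perm_big _ (perm_to_rem ar)) big_cons lerD2l.
  apply: IH => [|i]; first exact: rem_uniq.
  by rewrite mem_rem_uniq // inE => /andP[ia /rs]; rewrite inE (negPf ia).
apply: (le_trans (IH r Ur _)) => [i ir|]; last by rewrite lerDr.
by have := rs i ir; rewrite inE => /predU1P[ia|//]; rewrite -ia ir in anr.
Qed.

(* Every cycle of length l is listed l times in each of its two directions. *)
Definition all_cycles (V : finType) : seq (seq V) :=
  [seq c <- [seq tval u | l <- index_iota 3 #|V|.+1, u <- enum {: l.-tuple V}]
    | uniq c].

Lemma mem_all_cycles (V : finType) (c : seq V) :
  uniq c -> (2 < size c)%N -> c \in all_cycles V.
Proof.
move=> Uc sc; rewrite mem_filter Uc; apply/allpairsPdep.
exists (size c), (in_tuple c); split=> //; last by rewrite mem_enum.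
by rewrite mem_index_iota sc ltnS -(card_uniqP Uc) max_card.
Qed.

(** Repeated vertices are allowed in the upper bound: at most |V|^l lists of length l contribute x^l
    / l each. *)
Lemma sum_all_cycles_le (R : realFieldType) (V : finType) (x : R) : 0 <= x ->
  \sum_(c <- all_cycles V) (size c)%:R^-1 * x ^+ #|cycle_edges c|
    <= \sum_(3 <= l < #|V|.+1) l%:R^-1 * (#|V|%:R * x) ^+ l.
Proof.
move=> x0; rewrite big_filter big_mkcond big_allpairs_dep.
rewrite big_nat_cond [leRHS]big_nat_cond.
apply: ler_sum => l /andP[/andP[l3 _] _].
apply: (@le_trans _ _ (\sum_(u <- enum {: l.-tuple V}) l%:R^-1 * x ^+ l)).
  apply: ler_sum => u _; case: ifP => Uu; last first.
    by rewrite mulr_ge0 ?invr_ge0 ?exprn_ge0.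
  by rewrite card_cycle_edges ?size_tuple.
rewrite big_enum /= sumr_const card_tuple exprMn -natrX.
by rewrite mulr_natl mulrnAr.
Qed.

(** Each of the t! cycles from [complete_minor_cycles] is listed with all its l rotations, each of
    weight 1/l, and so contributes 1. *)
Lemma complete_minor_weight (R : realFieldType) (V : finType) (S : {set V}) E t :
  (0 < t)%N -> admits_complete_minor S E t.+2 ->
  t`!%:R <= \sum_(c <- all_cycles V | cycle_edges c \subset E) (size c)%:R^-1 :> R.
Proof.
move=> t0 /complete_minor_cycles[y [cs [Ucs <- csP]]].
pose rots := [seq rot i c | c <- cs, i <- iota 0 (size c)].
have -> : (size cs)%:R = \sum_(c <- rots) (size c)%:R^-1 :> R.
  rewrite big_allpairs_dep -sum1_size natr_sum big_seq [RHS]big_seq.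
  apply: eq_bigr => c /csP[_ _ sc _]; under eq_bigr do rewrite size_rot.
  rewrite big_const_seq count_predT size_iota iter_addr addr0
    -[_^-1 *+ _]mulr_natr.
  by rewrite mulVf // pnatr_eq0; lia.
rewrite -[leRHS]big_filter; apply: ler_sum_uniq_subset => [c||c].
- by rewrite invr_ge0.
(* Since all these cycles start at y, [rot_index_uniq] recovers cycle and offset from a rotation. *)
- apply: allpairs_uniq_dep => // [c _|]; first exact: iota_uniq.
  move=> _ _ /allpairsPdep[c [i [ccs + ->]]] /allpairsPdep[d [j [dcs + ->]]] /=.
  rewrite !mem_iota !add0n /= => ic jd eq_rot.
  case: (csP c ccs) (csP d dcs) => Uc _ _ hc [Ud _ _ hd].
  case: c hc Uc ic eq_rot {ccs} => [//|_ p] [->] Uc ic.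
  case: d hd Ud jd {dcs} => [//|_ p'] [->] Ud jd eq_rot.
  have [rc ->] := rot_index_uniq Uc ic; have [rd ->] := rot_index_uniq Ud jd.
  have eq_c : y :: p = y :: p' by rewrite -rc -rd eq_rot.
  by move: eq_rot; case: eq_c => <- ->.
- case/allpairsPdep=> d [i [/csP[Ud cd sd _] _ ->]].
  rewrite mem_filter cycle_edges_sub ?rot_cycle //=.
  by apply: mem_all_cycles; rewrite ?rot_uniq ?size_rot //; apply: leq_trans sd.
Qed.

(** A minor would make the weight of Client's cycles at least t!, above what his strategy
    permits. *)
Lemma client_avoids_minor (R : realFieldType) (n t q : nat) : (0 < t)%N ->
  \sum_(3 <= l < n.+1) l%:R^-1 * (n%:R / q.+1%:R) ^+ l < t`!%:R :> R ->
  client_has_winning_strategy (complete_edges n) (minor_family n t.+2) q.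
Proof.
move=> t0 sum_lt.
have [|s [s_legal sP]] := @client_weighted_count R _ (complete_edges n) q set0 _
  (all_cycles 'I_n) (fun c => (size c)%:R^-1) (@cycle_edges _).
  by move=> c; rewrite invr_ge0.
exists s; split=> // h /sP weight_le _ [A].
rewrite inE => /existsP[S /andP[_ minA]] sA.
have := le_lt_trans weight_le; rewrite (eq_bigr (fun c => (size c)%:R^-1 *
  (q.+1%:R^-1) ^+ #|cycle_edges c|)); last by move=> c _; rewrite exprVn.
move=> /(_ t`!%:R); case/(_ _)/idPn.
  apply: le_lt_trans sum_lt; apply: le_trans (sum_all_cycles_le _ _) _.
    by rewrite invr_ge0.
  by rewrite card_ord.
rewrite -leNgt; apply: le_trans (complete_minor_weight _ t0 minA) _.
rewrite big_mkcond [leRHS]big_mkcond; apply: ler_sum => c _.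
case: ifP => [cA|_]; first by rewrite (subset_trans cA sA).
by case: ifP => // _; rewrite invr_ge0.
Qed.

(* Logarithmic and factorial estimates *)
From mathcomp Require Import all_classical all_reals all_analysis.

Import numFieldNormedType.Exports.

Local Open Scope classical_set_scope.

Section LogarithmicBounds.
Variable R : realType.
Implicit Types x : R.

Lemma ln_le_subr1 x : 0 < x -> ln x <= x - 1.
Proof. by move=> x0; rewrite -{1}(subrKC 1 x) le_ln1Dx //; lra. Qed.

Lemma ln_le_half x : 0 < x -> ln x <= x / 2.
Proof.
move=> x0; have -> : x = (x / 2) * 2 by lra.
rewrite lnM ?posrE; [|lra|lra].
have := @ln_le_subr1 (x / 2) ltac:(lra); have := @ln_le_subr1 2 ltac:(lra); lra.
Qed.

Lemma ln_succ_sub_ge n : (0 < n)%N -> n.+1%:R^-1 <= ln n.+1%:R - ln n%:R :> R.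
Proof.
move=> n0; have n0R : 0 < n%:R :> R by rewrite ltr0n.
have n1R : 0 < n.+1%:R :> R by rewrite ltr0n.
have := @ln_le_subr1 (n%:R / n.+1%:R) (divr_gt0 n0R n1R).
rewrite ln_div ?posrE //.
have -> : n%:R / n.+1%:R - 1 = - n.+1%:R^-1 :> R.
  by rewrite -natr1 in n1R *; field; rewrite lt0r_neq0.
by rewrite lerNr opprB.
Qed.

Lemma sum_inv_le_ln n : (0 < n)%N -> \sum_(3 <= l < n.+1) l%:R^-1 <= ln n%:R :> R.
Proof.
case: n => // n _; elim: n => [|n IH]; first by rewrite big_geq // ln1.
have lnS := @ln_succ_sub_ge n.+1 isT.
case: n IH lnS => [|n] IH lnS; first by rewrite big_geq // ln_ge0 // ler1n.
by rewrite big_nat_recr //= (le_trans (lerD IH lnS)) // addrC subrK.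
Qed.

(** This is m! >= (m/e)^m; the induction step rests on m ln(1 + 1/m) <= 1. *)
Lemma ln_fact_ge m : m%:R * (ln m%:R - 1) <= ln m`!%:R :> R.
Proof.
elim: m => [|[|m] IH]; first by rewrite mul0r fact0 ln1.
  by rewrite (_ : 1`! = 1%N) // ln1; lra.
have m0 : 0 < m.+1%:R :> R by rewrite ltr0n.
rewrite factS natrM lnM ?posrE ?ltr0n ?fact_gt0 //.
have : ln (1 + m.+1%:R^-1) <= m.+1%:R^-1 :> R.
  by apply: le_ln1Dx; rewrite (lt_le_trans (ltrN10 _)) ?invr_ge0 ?ltW.
have -> : 1 + m.+1%:R^-1 = m.+2%:R / m.+1%:R :> R.
  by rewrite -(natr1 m.+1); field; rewrite lt0r_neq0.
rewrite ln_div ?posrE ?ltr0n // -(ler_pM2l m0) mulfV ?lt0r_neq0 //.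
rewrite -(natr1 m.+1).
move: m.+1%:R (ln (m.+1%:R + 1)) (ln m.+1%:R) (ln m.+1`!%:R) m0 IH.
move=> y u v w y0 IH uv.
lra.
Qed.

(** For a <= n/2, the ratio is at most 1 + 2a/n <= exp(2a/n), and l <= n. *)
Lemma ratio_expn_le (n a q l : nat) : (a.*2 <= n)%N -> (n - a <= q)%N ->
  (l <= n)%N -> (n%:R / q.+1%:R) ^+ l <= expR (2 * a%:R) :> R.
Proof.
move=> an naq l_n; have [n0|n0] := posnP n.
  by move: l_n; rewrite n0 leqn0 => /eqP->; rewrite expr0 -expR0 ler_expR mulr_ge0.
have n0R : 0 < n%:R :> R by rewrite ltr0n.
have anR : 2 * a%:R <= n%:R :> R by rewrite -natrM ler_nat mul2n.
have naqR : n%:R <= q%:R + a%:R :> R by rewrite -natrD ler_nat; lia.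
have ratio_le : n%:R / q.+1%:R <= expR (2 * a%:R / n%:R) :> R.
  apply: le_trans (expR_ge1Dx _); rewrite ler_pdivrMr ?ltr0n // -natr1.
  have -> : 1 + 2 * a%:R / n%:R = (n%:R + 2 * a%:R) / n%:R :> R.
    by field; rewrite lt0r_neq0.
  rewrite mulrAC ler_pdivlMr //.
  have a0 : 0 <= a%:R :> R by [].
  by nra.
apply: (@le_trans _ _ (expR (2 * a%:R / n%:R) ^+ l)).
  by rewrite lerXn2r ?nnegrE ?expR_ge0 ?divr_ge0.
rewrite -expRM_natl ler_expR mulrA ler_pdivrMr // [leLHS]mulrC.
by rewrite ler_wpM2l ?mulr_ge0 ?ler_nat.
Qed.

(** With y = log log n and x = t, this follows from y / ln y >= 1. *)
Lemma minor_order_ge (x y : R) : expR 1 <= y ->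
  expR 8 * y / ln y <= x -> expR 8 <= x.
Proof.
move=> y_ge; apply: le_trans.
have e1 := expR_ge1Dx (1 : R).
have ln_y : 1 <= ln y by rewrite -[1]expRK ler_ln ?posrE; lra.
have ln_y_le : ln y <= y by apply/ltW/ln_sublinear; lra.
by rewrite ler_pdivlMr ?ler_pM2l ?expR_gt0 //; lra.
Qed.

(** Applied with L = log n, x = t and a = alpha, so that m! is (t - 2)!. Everything is compared with
    x ln x. *)
Lemma fact_gt_of_minor_order (L x a : R) m : expR 1 <= ln L -> 0 < L ->
  x = m.+2%:R ->
  expR 8 * ln L / ln (ln L) <= x -> a < 16^-1 * x * ln x ->
  L * expR (2 * a) < m`!%:R.
Proof.
move=> L2e L0 xE xge ax; set L2 := ln L in L2e xge; set L3 := ln L2 in xge.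
have e1 : 2 <= expR 1 :> R by have := expR_ge1Dx (1 : R); lra.
have e8 : 9 <= expR 8 :> R by have := expR_ge1Dx (8 : R); lra.
have L3ge : 1 <= L3 by rewrite -[1]expRK ler_ln ?posrE; lra.
have C0 : 0 < expR 8 * L2 / L3 by rewrite divr_gt0 ?mulr_gt0 //; lra.
have x0 : 0 < x by lra.
have xC : expR 8 <= x by exact: minor_order_ge xge.
have lnx8 : 8 <= ln x by rewrite -[8]expRK ler_ln ?posrE; lra.
(* The lower bound on x gives ln x >= 8 + L3 - ln L3, and ln L3 <= L3 / 2. *)
have lnxL3 : L3 / 2 <= ln x.
  have : ln (expR 8 * L2 / L3) <= ln x by rewrite ler_ln ?posrE.
  rewrite ln_div ?posrE; [|by rewrite mulr_gt0; lra|by lra].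
  rewrite lnM ?posrE; [|by lra|by lra].
  by rewrite expRK -/L3; have := @ln_le_half L3 ltac:(lra); lra.
have xlnx : 9 * L2 / 2 <= x * ln x.
  have -> : 9 * L2 / 2 = (9 * L2 / L3) * (L3 / 2) by field; lra.
  apply: ler_pM => //; [|by lra|].
    by rewrite divr_ge0 ?mulr_ge0; lra.
  apply: le_trans xge; rewrite ler_pM2r ?invr_gt0; last by lra.
  by rewrite ler_pM2r; lra.
have mE : m%:R = x - 2 :> R by rewrite xE -addn2 natrD addrK.
have m0 : 0 < m%:R :> R by lra.
(* Uses m = x - 2 >= x/2 and ln 2 <= 1. *)
have lnm : ln x - 1 <= ln m%:R.
  have : ln x <= ln (m%:R * 2) by rewrite ler_ln ?posrE; lra.
  by rewrite lnM ?posrE //; have := @ln_le_subr1 2 ltac:(lra); lra.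
have lnf : x / 2 * (ln x - 2) <= ln m`!%:R.
  apply: le_trans (ln_fact_ge m); apply: ler_pM; lra.
have f0 : 0 < m`!%:R :> R by rewrite ltr0n fact_gt0.
rewrite -[ltLHS]lnK ?posrE ?mulr_gt0 ?expR_gt0 // -[ltRHS]lnK ?posrE // ltr_expR.
rewrite lnM ?posrE ?expR_gt0 // expRK -/L2.
have : 8 * x <= x * ln x by rewrite mulrC ler_pM2l.
have : x / 2 * (ln x - 2) = x * ln x / 2 - x by field.
(* In units of x ln x, L2 is at most 2/9, 2a is below 1/8 and x is at most 1/8; their sum 17/36 is
   below 1/2. *)
move: ax lnf; rewrite -mulrA.
lra.
Qed.

End LogarithmicBounds.

Theorem theorem1p2 (R : realType) :
  exists C c : R, 0 < C /\ 0 < c /\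
    forall t alpha : nat -> nat,
      (\forall n \near \oo,
         C * ln (ln n%:R) / ln (ln (ln n%:R)) <= (t n)%:R) ->
      (\forall n \near \oo, (alpha n)%:R < c * (t n)%:R * ln (t n)%:R) ->
      (fun n : nat => (alpha n)%:R : R) =o_\oo (fun n : nat => n%:R : R) ->
      \forall n \near \oo, forall q : nat,
        n%:Z - (alpha n)%:Z <= q%:Z ->
        client_has_winning_strategy (complete_edges n) (minor_family n (t n)) q.
Proof.
(* C = e^8 gives ln t >= 8 and t ln t >= (9/2) log log n; c = 1/16 keeps 2 alpha below (t ln
   t)/8. *)
exists (expR 8), 16^-1; split; [exact: expR_gt0 | split; first by lra].
move=> t alpha t_ge alpha_lt /eqoP/(_ (2^-1) ltac:(lra)) alpha_o.
near=> n => q nq.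
(* This threshold makes log log n >= e, hence log log log n >= 1. *)
have n_large : expR (expR (expR 1)) <= n%:R :> R.
  by near: n; exact: nbhs_infty_ger.
have n0 : 0 < n%:R :> R by rewrite (lt_le_trans _ n_large) ?expR_gt0.
have lnn : expR (expR 1) <= ln n%:R :> R.
  by rewrite -[leLHS]expRK ler_ln ?posrE ?expR_gt0.
have lnn0 : 0 < ln n%:R :> R by rewrite (lt_le_trans _ lnn) ?expR_gt0.
have lnlnn : expR 1 <= ln (ln n%:R) :> R.
  by rewrite -[leLHS]expRK ler_ln ?posrE ?expR_gt0.
have alpha_n : ((alpha n).*2 <= n)%N.
  have : `|(alpha n)%:R| <= 2^-1 * `|n%:R| :> R by near: n.
  rewrite !ger0_norm // -mul2n -(ler_nat R) natrM; lra.
have tn : expR 8 * ln (ln n%:R) / ln (ln (ln n%:R)) <= (t n)%:R :> R by near: n.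
have an : (alpha n)%:R < 16^-1 * (t n)%:R * ln (t n)%:R :> R by near: n.
have := minor_order_ge lnlnn tn; have := expR_ge1Dx (8 : R) => e8 t8.
have t3 : (2 < t n)%N by rewrite -(ler_nat R); lra.
case tE : (t n) t3 => [|[|m]] // m0.
apply: (@client_avoids_minor R); first by rewrite ltnS in m0.
have naq : (n - alpha n <= q)%N by lia.
apply: le_lt_trans (fact_gt_of_minor_order lnlnn lnn0 (congr1 _ tE) tn an).
(* Each power is at most exp(2 alpha), which leaves a harmonic sum bounded by log n. *)
apply: le_trans (ler_wpM2r (expR_ge0 _) (sum_inv_le_ln R _)); last first.
  by rewrite -(ltr_nat R).
rewrite mulr_suml big_nat_cond [leRHS]big_nat_cond.
apply: ler_sum => l /andP[/andP[_ ln] _].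
by rewrite ler_wpM2l ?invr_ge0 // ratio_expn_le.
Unshelve. all: by end_near. Qed.
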